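(* Let $S_1,S_2$ be plane rooted trees such that $S_1\subseteq S_2$. Then $$\lim_{n\to\infty}\sqrt{n}\,\frac{g_{\mathcal{T}_n}(S_1)}{a_{\mathcal{T}_n}(S_1)}\le\lim_{n\to\infty}\sqrt{n}\,\frac{g_{\mathcal{T}_n}(S_2)}{a_{\mathcal{T}_n}(S_2)}.$$
   Context: $\mathcal{T}_n$ is the set of planted plane trees (rooted plane trees, each node having any number of ordered children) with $n$ nodes. A rooted tree is viewed as a poset with $v\le w$ iff $w$ is an ancestor of $v$ or equal to it. For incomparable vertices $x,y$ of a plane tree, $x$ is left of $y$ if at their lowest common ancestor the child leading to $x$ precedes the child leading to $y$. A (plane) embedding of $S$ into a plane tree $T$ is a vertex subset $E$ of $T$ whose induced subposet is isomorphic to $S$ via an isomorphism preserving the left-to-right order of children of each vertex of $S$; it is good if $E$ contains the root of $T$. $S\subseteq T$ means at least one embedding of $S$ into $T$ exists. $a_{\mathcal{T}_n}(S)$ (resp. $g_{\mathcal{T}_n}(S)$) is the total number of embeddings (resp. good embeddings) of $S$ into all trees of $\mathcal{T}_n$. *)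

(* Defs.v *)
From HB Require Import structures.
From mathcomp Require Import all_boot all_order all_algebra.
From mathcomp Require Import all_classical all_reals all_analysis.

Set Implicit Arguments.
Unset Strict Implicit.
Unset Printing Implicit Defensive.

Inductive ptree : Type := Node of seq ptree.

(* Vertices of a plane tree are encoded by their addresses: the root is [::],
   and the address of a vertex is the sequence of (0-based) child indices on the
   path from the root to it. *)
Fixpoint verts (t : ptree) : seq (seq nat) :=
  let: Node ts := t in
  [::] :: (fix verts_l (i : nat) (ts : seq ptree) : seq (seq nat) :=
             match ts with
             | [::] => [::]
             | t' :: ts' => [seq i :: v | v <- verts t'] ++ verts_l i.+1 ts'
             end) 0 ts.

(* forests fuel k : all ordered forests with exactly k nodes (needs fuel > k). *)
Fixpoint forests (fuel k : nat) : seq (seq ptree) :=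
  match fuel with
  | 0 => [::]
  | fuel'.+1 =>
    if k is 0 then [:: [::]] else
    flatten [seq flatten [seq [seq Node f1 :: f2 | f2 <- forests fuel' (k - j.+1)]
                         | f1 <- forests fuel' j]
            | j <- iota 0 k]
  end.

(* T_n : the list of all planted plane trees with n nodes (each exactly once). *)
Definition trees (n : nat) : seq ptree :=
  if n is m.+1 then [seq Node f | f <- forests m.+1 m] else [::].

Fixpoint subsets {A : Type} (s : seq A) : seq (seq A) :=
  match s with
  | [::] => [:: [::]]
  | x :: s' => [seq x :: e | e <- subsets s'] ++ subsets s'
  end.

(* Poset order on addresses: v <= w iff w is an ancestor of v or equal,
   i.e. w is a prefix of v. *)
Definition tle (v w : seq nat) : Prop := exists u, v = w ++ u.

(* x is left of y: at their lowest common ancestor p, the child leading to x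
   precedes the child leading to y. *)
Definition leftof (x y : seq nat) : Prop :=
  exists (p x' y' : seq nat) (i j : nat), x = p ++ i :: x' /\ y = p ++ j :: y' /\ i < j.

(* E (a set of vertices of T) is a plane embedding of S into T: there is an
   isomorphism f from the poset of vertices of S onto the induced subposet E
   of T, preserving the left-to-right order of the children of each vertex of S. *)
Definition is_embedding (S T : ptree) (E : seq (seq nat)) : Prop :=
  {subset E <= verts T} /\
  exists f : seq nat -> seq nat,
    {in verts S &, injective f} /\
    (forall y, y \in E <-> exists2 x, x \in verts S & f x = y) /\
    {in verts S &, forall x y, tle x y <-> tle (f x) (f y)} /\
    (forall (p : seq nat) (i j : nat),
        rcons p i \in verts S -> rcons p j \in verts S -> i < j ->
        leftof (f (rcons p i)) (f (rcons p j))).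

Definition is_good_embedding (S T : ptree) (E : seq (seq nat)) : Prop :=
  is_embedding S T E /\ [::] \in E.

Definition ptree_sub (S T : ptree) : Prop := exists E, is_embedding S T E.

Definition num_emb (S T : ptree) : nat :=
  count (fun E => `[< is_embedding S T E >]) (subsets (verts T)).
Definition num_good_emb (S T : ptree) : nat :=
  count (fun E => `[< is_good_embedding S T E >]) (subsets (verts T)).

Definition aT (n : nat) (S : ptree) : nat := \sum_(T <- trees n) num_emb S T.
Definition gT (n : nat) (S : ptree) : nat := \sum_(T <- trees n) num_good_emb S T.

Definition good_ratio (R : realType) (S : ptree) (n : nat) : R :=
  Num.sqrt (n%:R) * ((gT n S)%:R / (aT n S)%:R).

(* Main.v *)
Require Import Defs.
From HB Require Import structures.
From mathcomp Require Import all_boot all_order all_algebra.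
From mathcomp Require Import ring lra.
From mathcomp Require Import all_classical all_reals all_analysis.
Import Order.TTheory GRing.Theory Num.Theory numFieldNormedType.Exports.
Local Open Scope ring_scope.
Local Open Scope classical_set_scope.

Set Implicit Arguments.
Unset Strict Implicit.
Unset Printing Implicit Defensive.

(* An embedding is determined by the shape of its vertex set in preorder, so the
   embeddings of a plane forest F into plane forests can be counted by splitting
   off the first tree of the host: the part of F placed in that tree is an initial
   segment of F, and it is placed below the root unless it is a single tree using
   the root.  With s = sqrt (1 - 4z) this yields, for the generating function Y_F
   of the embeddings of F (times z), Y_[] = (1 - s) / 2 and
     s Y_F = Y_[] Y_F'                                    if F = [Node F'],
     s Y_F = sum of (Y_A + Y_A' [A = Node A']) Y_B over F = A B, A and B nonempty,
   otherwise.  Hence Y_F = c s^(-w) + lower order terms with c > 0, where w is the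
   number of vertices plus the number of leaves minus 2 when F is the forest of
   the children of the root of S.  All embeddings of S = Node F are counted by
   (1 + s) / (2 s) Y_F, so the limit for S is 2 rho_w, where rho_w is the limit of
   sqrt n e_w(n) / e_(w+1)(n) and e_b(n) is the n-th coefficient of s^(-b).  By
   log-concavity of b |-> e_b(n), rho_w is nondecreasing in w, and so is w along
   embeddings. *)

(** * Embeddings and preorder codes *)

Section Embeddings.
Local Open Scope nat_scope.

Definition children (t : ptree) : seq ptree := let: Node F := t in F.

(** A forest is read as a binary tree whose two branches are the children of its first tree and the
    remaining trees; both branches get an induction hypothesis in spite of the nested type. *)
Lemma forest_ind (P : seq ptree -> Prop) :
  P [::] -> (forall F1 F2, P F1 -> P F2 -> P (Node F1 :: F2)) -> forall F, P F.
Proof.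
move=> P0 PS F.
pose loop := fix loop (t : ptree) : P (children t) :=
  match t return P (children t) with Node F =>
    (fix inner (F : seq ptree) : P F :=
      match F return P F with
      | [::] => P0
      | t :: F2 =>
        match t return P (children t) -> P (t :: F2) with
        | Node F1 => fun h => PS F1 F2 h (inner F2)
        end (loop t)
      end) F
  end.
exact: (loop (Node F)).
Qed.

Fixpoint fverts (i : nat) (F : seq ptree) : seq (seq nat) :=
  if F is t :: F' then [seq i :: v | v <- verts t] ++ fverts i.+1 F' else [::].

Lemma verts_Node F : verts (Node F) = [::] :: fverts 0 F.
Proof. by []. Qed.

Lemma fverts_cons i t F :
  fverts i (t :: F) = [seq i :: v | v <- verts t] ++ fverts i.+1 F.
Proof. by []. Qed.

(* Preorder: the lexicographic order on addresses. *)
Fixpoint ltx (x y : seq nat) : bool :=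
  match x, y with
  | _, [::] => false
  | [::], _ :: _ => true
  | a :: x', b :: y' => (a < b) || ((a == b) && ltx x' y')
  end.

Lemma ltx_trans : transitive ltx.
Proof.
elim=> [|b y IH] [|a x] [|c z] //=.
case/orP=> [ab|/andP[/eqP-> xy]]; case/orP=> [bc|/andP[/eqP<- yz]].
- by rewrite (ltn_trans ab bc).
- by rewrite ab.
- by rewrite bc.
- by rewrite eqxx (IH _ _ xy yz) orbT.
Qed.

Lemma ltx_irr : irreflexive ltx.
Proof. by elim=> //= a x ->; rewrite ltnn andbF. Qed.

Lemma ltx_cat p x y : ltx (p ++ x) (p ++ y) = ltx x y.
Proof. by elim: p => //= a p ->; rewrite ltnn eqxx. Qed.

Lemma tleP v w : reflect (tle v w) (prefix w v).
Proof. exact: prefixP. Qed.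

Lemma leftof_ltx x y : leftof x y -> ltx x y.
Proof. by move=> [p [x' [y' [i [j [-> [-> ij]]]]]]]; rewrite ltx_cat /= ij. Qed.

Lemma leftof_prefix x y u v : leftof x y -> leftof (x ++ u) (y ++ v).
Proof.
move=> [p [x' [y' [i [j [-> [-> ij]]]]]]].
by exists p, (x' ++ u), (y' ++ v), i, j; rewrite -!catA.
Qed.

Lemma ltx_cases x y : ltx x y -> prefix x y \/ leftof x y.
Proof.
elim: x y => [|a x IH] [|b y] //=; first by left.
case/orP=> [ab|/andP[/eqP<- /IH[xy|[p [x' [y' [i [j [-> [-> ij]]]]]]]]]].
- by right; exists [::], x, y, a, b.
- by left; rewrite eqxx.
- by right; exists (a :: p), x', y', i, j.
Qed.

Lemma prefix_ltx x y : prefix x y -> x != y -> ltx x y.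
Proof.
elim: x y => [|a x IH] [|b y] //= /andP[/eqP<- xy].
by rewrite eqseq_cons eqxx /= ltnn => /(IH _ xy).
Qed.

Lemma ltx_not_prefix x y : ltx x y -> ~~ prefix y x.
Proof.
elim: x y => [|a x IH] [|b y] //=.
by case/orP=> [ab|/andP[_ /IH/negbTE->]]; rewrite ?andbF // gtn_eqF.
Qed.

(** Subtrees are contiguous in preorder; this lets the number of descendants stand for the set of
    descendants. *)
Lemma prefix_between x y z : ltx x y -> ltx y z -> prefix x z -> prefix x y.
Proof.
elim: x y z => [|a x IH] [|b y] [|c z] //=.
move=> h1 h2 /andP[/eqP ac pxz]; subst c; move: h1 h2.
case: (ltngtP a b) => //= ab; subst b; by move=> xy yz; exact: IH xy yz pxz.
Qed.

Lemma fverts_head i F v : v \in fverts i F -> exists2 j, i <= j & exists u, v = j :: u.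
Proof.
elim: F i => // t F IH i /=; rewrite mem_cat => /orP[/mapP[u _ ->]|/IH[j ij vj]].
  by exists i => //; exists u.
by exists j => //; apply: ltnW.
Qed.

Lemma sorted_fverts i F : sorted ltx (fverts i F).
Proof.
rewrite sorted_pairwise; last exact: ltx_trans.
elim/forest_ind: F i => // F1 F2 IH1 IH2 i; rewrite fverts_cons.
rewrite pairwise_cat IH2 andbT pairwise_map; apply/andP; split.
  apply/allrelP => x y /mapP[u _ ->] /fverts_head[j ij [w ->]] /=.
  by rewrite ij.
apply: (@sub_pairwise _ ltx); first by move=> x y /=; rewrite ltnn eqxx.
rewrite verts_Node /= IH1 andbT.
by apply/allP => x /fverts_head[j _ [w ->]].
Qed.

Lemma sorted_verts t : sorted ltx (verts t).
Proof.
case: t => F; rewrite verts_Node sorted_pairwise; last exact: ltx_trans.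
rewrite /= -sorted_pairwise ?sorted_fverts ?andbT; last exact: ltx_trans.
by apply/allP => x /fverts_head[j _ [w ->]].
Qed.

Lemma sorted_ltx_uniq l : sorted ltx l -> uniq l.
Proof. exact: sorted_uniq ltx_trans ltx_irr l. Qed.

Lemma mem_fverts_cons i a v F :
  (i + a :: v \in fverts i F) = (a < size F) && (v \in verts (nth (Node [::]) F a)).
Proof.
elim: F i a => [|t F IH] i a //=; rewrite mem_cat.
case: a => [|a] /=.
  rewrite addn0 mem_map; last by move=> x y [].
  case: (boolP (_ \in fverts _ _)) => [/fverts_head[j ij [u [eij _]]]|]; last by rewrite orbF.
  by rewrite eij ltnn in ij.
rewrite addnS -addSn IH ltnS; case: mapP => // -[u _ [e _]].
by move: (leq_addr a i.+1); rewrite e ltnn.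
Qed.

Lemma verts_prefix t x y : prefix x y -> y \in verts t -> x \in verts t.
Proof.
elim: x t y => [|a x IH] [F] [|b y] //= /andP[/eqP<- xy].
rewrite -/(fverts 0 F) !inE /= -[a]add0n !mem_fverts_cons => /andP[-> ] /=.
exact: IH xy.
Qed.

Lemma count_prefix_nil (l : seq (seq nat)) : count (prefix [::]) l = size l.
Proof. by rewrite -count_predT; apply: eq_count => x; rewrite prefix0s. Qed.

(* For a preorder list of addresses this lists the numbers of proper descendants
   within the list, which determines the shape of the induced plane forest. *)
Fixpoint desc_counts (l : seq (seq nat)) : seq nat :=
  if l is x :: l' then count (prefix x) l' :: desc_counts l' else [::].

Lemma size_desc_counts l : size (desc_counts l) = size l.
Proof. by elim: l => //= x l ->. Qed.

Lemma desc_counts_map f l :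
  {in l &, forall x y, prefix (f x) (f y) = prefix x y} ->
  desc_counts (map f l) = desc_counts l.
Proof.
elim: l => //= x l IH H; rewrite IH; last first.
  by move=> u v ul vl; apply: H; rewrite inE ?ul ?vl orbT.
congr (_ :: _); rewrite count_map; apply: eq_in_count => y yl /=.
by apply: H; rewrite inE ?eqxx ?yl ?orbT.
Qed.

Lemma desc_counts_cat l1 l2 :
  {in l1 & l2, forall x y, ~~ prefix x y} ->
  desc_counts (l1 ++ l2) = desc_counts l1 ++ desc_counts l2.
Proof.
elim: l1 => //= x l1 IH H; rewrite IH; last first.
  by move=> u v ul vl; apply: H; rewrite // inE ul orbT.
rewrite count_cat (@eq_in_count _ _ pred0 l2) ?count_pred0 ?addn0 //.
by move=> y yl; apply/negbTE/H; rewrite // inE eqxx.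
Qed.

(** The descendants of an entry occupy the positions right after it, so their number decides which
    entries are below it. Hence the code determines the induced order. *)
Lemma prefix_nth l a b : sorted ltx l -> a < size l -> b < size l ->
  prefix (nth [::] l a) (nth [::] l b) = (a <= b <= a + nth 0 (desc_counts l) a).
Proof.
elim: l a b => //= x l IH [|a] [|b] /=.
- by rewrite prefix_refl.
- rewrite add0n ltnS => sl _ bl.
  have {}sl : pairwise ltx (x :: l) by rewrite -sorted_pairwise //; exact: ltx_trans.
  elim: l b bl sl {IH} => //= y l IH b bl.
  move=> /andP[/andP[xy xl] /andP[yl pl]].
  case: b bl => [|b] bl /=; last rewrite IH ?xl //.
  (* If the next entry is not below [x], contiguity leaves [x] without descendants in the list. *)
  + case pxy: (prefix x y) => //.
    rewrite (@eq_in_count _ _ pred0 l) ?count_pred0 // => z zl /=.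
    apply/negbTE/negP => xz; move/negP: pxy; apply.
    by apply: prefix_between xz => //; exact: (allP yl).
  + case pxy: (prefix x y) => //.
    rewrite (@eq_in_count _ _ pred0 l) ?count_pred0 // => z zl /=.
    apply/negbTE/negP => xz; move/negP: pxy; apply.
    by apply: prefix_between xz => //; exact: (allP yl).
- move=> sl al _; apply/negbTE/ltx_not_prefix.
  by move: (order_path_min ltx_trans sl) => /allP; apply; apply: mem_nth.
- by move=> sl al bl; rewrite IH // (path_sorted sl).
Qed.

Fixpoint tcode (t : ptree) : seq nat :=
  let: Node F := t in size (flatten (map tcode F)) :: flatten (map tcode F).

Definition fcode (F : seq ptree) : seq nat := flatten (map tcode F).

Lemma fcode_cons F1 F2 :
  fcode (Node F1 :: F2) = size (fcode F1) :: fcode F1 ++ fcode F2.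
Proof. by []. Qed.

Lemma fcode_cat F1 F2 : fcode (F1 ++ F2) = fcode F1 ++ fcode F2.
Proof. by rewrite /fcode map_cat flatten_cat. Qed.

(** The leading entry is the length of the code of the first tree's children, so it marks where the
    code of the next tree begins. *)
Lemma fcode_inj : injective fcode.
Proof.
elim/forest_ind=> [|F1 F2 IH1 IH2] [|[G1] G2] //.
rewrite !fcode_cons => -[es /eqP]; rewrite eqseq_cat // => /andP[/eqP e1 /eqP e2].
by rewrite (IH1 _ e1) (IH2 _ e2).
Qed.

Lemma fverts_cons_prefix i j x y F :
  i < j -> y \in fverts j F -> ~~ prefix (i :: x) y.
Proof. by move=> ij /fverts_head[k jk [u ->]] /=; rewrite ltn_eqF ?(leq_trans ij). Qed.

Lemma desc_counts_fverts i F : desc_counts (fverts i F) = fcode F.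
Proof.
elim/forest_ind: F i => // F1 F2 IH1 IH2 i; rewrite fcode_cons.
rewrite fverts_cons desc_counts_cat; last first.
  by move=> x y /mapP[u _ ->] /fverts_cons_prefix; apply.
rewrite desc_counts_map; last by move=> x y _ _ /=; rewrite eqxx.
rewrite verts_Node /= IH1 IH2.
have -> : size (fcode F1) = size (fverts 0 F1) by rewrite -(IH1 0) size_desc_counts.
by rewrite count_prefix_nil.
Qed.

Lemma desc_counts_verts t : desc_counts (verts t) = fcode [:: t].
Proof.
case: t => F; rewrite verts_Node fcode_cons cats0 /= desc_counts_fverts.
have -> : size (fcode F) = size (fverts 0 F).
  by rewrite -(desc_counts_fverts 0) size_desc_counts.
by rewrite count_prefix_nil.
Qed.

(** * Embeddings recognised by their codes *)

Lemma mem_subsets (A : eqType) (s e : seq A) : e \in subsets s -> subseq e s.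
Proof.
elim: s e => [|x s IH] e /=; first by rewrite inE => /eqP->.
rewrite mem_cat => /orP[/mapP[u /IH us ->]|/IH es]; first by rewrite /= eqxx.
exact: subseq_trans es (subseq_cons _ _).
Qed.


Lemma filter_in_subsets (A : eqType) (a : pred A) (s : seq A) :
  [seq x <- s | a x] \in subsets s.
Proof.
elim: s => //= x s IH; case: (a x); rewrite mem_cat ?IH ?orbT //.
by rewrite map_f.
Qed.

(** An isomorphism that respects ancestry and the order of siblings respects preorder, so it maps
    [verts S] to [E] entry by entry and keeps all descendant counts. Conversely, equal counts give
    equal ancestry relations between positions. *)
Lemma is_embeddingP S T E : subseq E (verts T) ->
  is_embedding S T E <-> desc_counts E = fcode [:: S].
Proof.
move=> sET; rewrite -desc_counts_verts.
have sS := sorted_verts S.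
have sE : sorted ltx E := subseq_sorted ltx_trans sET (sorted_verts T).
split=> [[_ [f [finj [fE [ftle fleft]]]]]|eqd].
  have -> : E = map f (verts S).
    apply: (irr_sorted_eq ltx_trans ltx_irr) => //; last first.
      move=> y; apply/idP/idP => [/fE[x xS <-]|/mapP[x xS ->]]; first exact: map_f.
      by apply/fE; exists x.
    rewrite sorted_pairwise ?pairwise_map; last exact: ltx_trans.
    move: sS; rewrite sorted_pairwise; last exact: ltx_trans.
    apply: (@sub_in_pairwise _ (mem (verts S))); last exact/allP.
    move=> x y xS yS xy /=.
    case: (ltx_cases xy) => [/tleP pxy|].
      apply: prefix_ltx; first exact/tleP/(ftle _ _ yS xS).
      apply: contraTneq xy => /finj -> //; by rewrite ltx_irr.
    (* For [x] left of [y], consider the siblings at which their branches separate: [f] keeps these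
       in order, and the images of [x] and [y] lie below theirs. *)
    move=> [p [x' [y' [i [j [ex [ey ij]]]]]]].
    have px : prefix (rcons p i) x by rewrite ex -cat_rcons prefix_prefix.
    have py : prefix (rcons p j) y by rewrite ey -cat_rcons prefix_prefix.
    have iS := verts_prefix px xS; have jS := verts_prefix py yS.
    have [u ->] : tle (f x) (f (rcons p i)) by apply/(ftle _ _ xS iS)/tleP.
    have [v ->] : tle (f y) (f (rcons p j)) by apply/(ftle _ _ yS jS)/tleP.
    by apply/leftof_ltx/leftof_prefix/fleft.
  apply: desc_counts_map => x y xS yS.
  by apply/idP/idP => /tleP h; apply/tleP/(ftle _ _ yS xS).
have szE : size E = size (verts S) by rewrite -!size_desc_counts eqd.
have uS := sorted_ltx_uniq sS; have uE := sorted_ltx_uniq sE.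
(* Both lists are in preorder, so the isomorphism has to match them position by position. *)
pose f x := nth [::] E (index x (verts S)).
have pf : {in verts S &, forall x y, prefix (f x) (f y) = prefix x y}.
  move=> x y xS yS; rewrite /f prefix_nth ?szE ?index_mem // eqd.
  by rewrite -prefix_nth ?index_mem // !nth_index.
split; first exact/mem_subseq.
exists f; split; [|split; [|split]].
- move=> x y xS yS /eqP; rewrite /f nth_uniq ?szE ?index_mem // => /eqP e.
  by rewrite -[x](nth_index [::] xS) e nth_index.
- move=> y; split=> [yE|[x xS <-]]; last by rewrite /f mem_nth // szE index_mem.
  exists (nth [::] (verts S) (index y E)).
    by rewrite mem_nth // -szE index_mem.
  by rewrite /f index_uniq -?szE ?index_mem // nth_index.
- by move=> x y xS yS; split=> /tleP h; apply/tleP; rewrite ?pf // -pf.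
(* Siblings are incomparable and positions keep their order; two incomparable vertices in preorder
   are in left-to-right order. *)
- move=> p i j iS jS ij.
  have ltij : ltx (rcons p i) (rcons p j) by rewrite -!cats1 ltx_cat /= ij.
  have npij : ~~ prefix (rcons p i) (rcons p j).
    apply/negP => /prefixP[u]; rewrite cat_rcons -cats1 => /eqP.
    rewrite eqseq_cat // => /andP[_ /eqP[ji _]].
    by rewrite ji ltnn in ij.
  case: (@ltx_cases (f (rcons p i)) (f (rcons p j))) => //.
    have lt_index : index (rcons p i) (verts S) < index (rcons p j) (verts S).
      rewrite ltnNge leq_eqVlt; apply/negP => /orP[/eqP e|h].
        move: ltij; rewrite -[rcons p i](nth_index [::] iS) -e nth_index //.
        by rewrite ltx_irr.
      have := sorted_ltn_nth ltx_trans [::] sS (index (rcons p j) (verts S))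
        (index (rcons p i) (verts S)).
      rewrite !inE !index_mem !nth_index // => /(_ jS iS h) /ltx_trans/(_ ltij).
      by rewrite ltx_irr.
    by apply: (sorted_ltn_nth ltx_trans) => //; rewrite inE szE index_mem.
  by rewrite pf // (negbTE npij).
Qed.

(** * Recursive counting of embeddings *)

Definition fcount (F ts : seq ptree) : nat :=
  count (fun E => desc_counts E == fcode F) (subsets (fverts 0 ts)).

Definition tcount (F : seq ptree) (t : ptree) : nat :=
  count (fun E => desc_counts E == fcode F) (subsets (verts t)).

Lemma num_embE S T : num_emb S T = tcount [:: S] T.
Proof.
apply: eq_in_count => E /mem_subsets /is_embeddingP h.
by apply/asboolP/eqP => /h.
Qed.

(** When the host root is chosen it is the top of the image, hence the image of the root of the
    pattern; the other chosen vertices embed [F] below it. *)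
Lemma num_good_embE F ts : num_good_emb (Node F) (Node ts) = fcount F ts.
Proof.
rewrite /num_good_emb /fcount verts_Node /= count_cat count_map.
rewrite [X in _ + X = _](@eq_in_count _ _ pred0); last first.
  move=> E /mem_subsets/mem_subseq h /=; apply/negbTE/negP => /asboolP[_ /h].
  by move/fverts_head => [j _ [u]].
rewrite count_pred0 addn0; apply: eq_in_count => E /mem_subsets sE /=.
have h : is_embedding (Node F) (Node ts) ([::] :: E) <->
  desc_counts ([::] :: E) = fcode [:: Node F].
  by apply: is_embeddingP; rewrite verts_Node /= .
rewrite fcode_cons cats0 /= in h.
apply/asboolP/eqP => [[/h[]] //|e].
split; last exact: mem_head.
by apply/h; rewrite e -e size_desc_counts count_prefix_nil.
Qed.

(** If the host root is chosen, every other chosen vertex lies below it, so the pattern must be a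
    single tree. *)
Lemma tcount_Node F ts :
  tcount F (Node ts) = fcount F ts + (if F is [:: Node F'] then fcount F' ts else 0).
Proof.
rewrite /tcount verts_Node /= count_cat addnC; congr (_ + _).
rewrite count_map.
have dE E : desc_counts ([::] :: E) = size (desc_counts E) :: desc_counts E.
  by rewrite /= size_desc_counts count_prefix_nil.
case: F => [|[F1] F2]; first by rewrite (@eq_count _ _ pred0) ?count_pred0.
case: F2 => [|[F2] F3].
  apply: eq_count => E; rewrite -[LHS]/(desc_counts ([::] :: E) == _) dE.
  rewrite fcode_cons cats0 eqseq_cons.
  by apply/andP/eqP => [[_ /eqP]|->].
rewrite (@eq_count _ _ pred0) ?count_pred0 // => E.
rewrite -[LHS]/(desc_counts ([::] :: E) == _) dE fcode_cons eqseq_cons /=.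
apply/negbTE/negP => /andP[/eqP e /eqP e2].
move: e; rewrite e2 size_cat /= => /eqP.
by rewrite -[X in _ == X]addn0 eqn_add2l.
Qed.

Lemma subsets_map (A B : Type) (f : A -> B) s :
  subsets (map f s) = map (map f) (subsets s).
Proof. by elim: s => //= x s ->; rewrite map_cat -!map_comp. Qed.

Lemma count_sum (A : Type) (a : pred A) s : count a s = \sum_(x <- s) a x.
Proof. by rewrite -sumn_count sumnE big_map. Qed.

Lemma count_subsets_cat (A : Type) (a : pred (seq A)) s1 s2 :
  count a (subsets (s1 ++ s2)) =
  \sum_(e1 <- subsets s1) \sum_(e2 <- subsets s2) a (e1 ++ e2).
Proof.
elim: s1 a => [|x s1 IH] a /=; first by rewrite big_seq1 count_sum.
by rewrite count_cat count_map big_cat big_map !IH.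
Qed.

(** The entries below the first one form the first tree and the others form the rest of the forest;
    both lists are shorter. *)
Lemma desc_counts_forest l : sorted ltx l -> exists F, desc_counts l = fcode F.
Proof.
have [n] := ubnP (size l); elim: n l => // n IH [|x l]; first by exists [::].
rewrite /= ltnS => ln xl; have sl := path_sorted xl.
have [||F1 e1] := IH [seq y <- l | prefix x y].
- by rewrite (leq_ltn_trans _ ln) // size_filter count_size.
- exact: sorted_filter ltx_trans _ _ sl.
have [||F2 e2] := IH [seq y <- l | ~~ prefix x y].
- by rewrite (leq_ltn_trans _ ln) // size_filter count_size.
- exact: sorted_filter ltx_trans _ _ sl.
exists (Node F1 :: F2); rewrite fcode_cons -e1 size_desc_counts size_filter -e2.
congr (_ :: _).
rewrite -desc_counts_cat; last first.
  move=> u v; rewrite !mem_filter => /andP[xu ul] /andP[xv vl].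
  by apply: contra xv => uv; exact: prefix_trans xu uv.
(* By contiguity, listing the descendants of [x] first and the other entries afterwards gives back
   [l]. *)
congr desc_counts; rewrite sorted_pairwise in sl; last exact: ltx_trans.
have xal := order_path_min ltx_trans xl.
elim: l xal sl {IH ln xl F1 e1 F2 e2} => //= y l IH /andP[xy xl] /andP[yl sl].
case pxy: (prefix x y) => /=; first by rewrite -IH.
have npz z : z \in l -> prefix x z = false.
  move=> zl; apply/negbTE/negP => xz; move/negP: pxy; apply.
  by apply: prefix_between xz => //; exact: (allP yl).
rewrite (eq_in_filter npz) filter_pred0 /=; congr (_ :: _).
rewrite (@eq_in_filter _ _ predT) ?filter_predT // => z /npz -> //.
Qed.

(** A factorisation of [F] into two forests is fixed by the length of the first, so at most one
    summand is nonzero. *)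
Lemma fcode_cat_split F F1 F2 :
  (fcode F1 ++ fcode F2 == fcode F) =
  \sum_(j < (size F).+1)
    (fcode F1 == fcode (take j F)) * (fcode F2 == fcode (drop j F)) :> nat.
Proof.
rewrite -fcode_cat; case: eqP => [/fcode_inj <-|ne].
  have h : size F1 < (size (F1 ++ F2)).+1 by rewrite size_cat ltnS leq_addr.
  rewrite (bigD1 (Ordinal h)) //= take_size_cat // drop_size_cat // !eqxx.
  rewrite big1 ?addn0 // => j; rewrite -val_eqE /= => nj.
  case: eqP => // /fcode_inj/(congr1 size).
  by rewrite size_takel -1?ltnS ?ltn_ord // => ej; rewrite -ej eqxx in nj.
rewrite big1 // => j _; case: eqP => // /fcode_inj e1; case: eqP => // /fcode_inj e2.
by case: ne; rewrite e1 e2 cat_take_drop.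
Qed.

(** No vertex of [t] is comparable with one of [ts], so the code of a vertex set is the
    concatenation of the codes of its two parts. *)
Lemma fcount_cons F t ts :
  fcount F (t :: ts) = \sum_(j < (size F).+1) tcount (take j F) t * fcount (drop j F) ts.
Proof.
(* The trees after the first are addressed from index 1 on, so the recursion is first proved for an
   arbitrary starting index; the counts do not depend on it. *)
pose c i F ts := count (fun E => desc_counts E == fcode F) (subsets (fverts i ts)).
have cE i G u us :
    c i G (u :: us) = \sum_(j < (size G).+1) tcount (take j G) u * c i.+1 (drop j G) us.
  rewrite [LHS]/c fverts_cons count_subsets_cat subsets_map big_map.
  under [RHS]eq_bigr => j _ do rewrite /tcount /c !count_sum big_distrl.
  rewrite [RHS]exchange_big; apply: eq_big_seq => /= e1 /mem_subsets s1.
  under [RHS]eq_bigr => j _ do rewrite big_distrr.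
  rewrite [RHS]exchange_big; apply: eq_big_seq => /= e2 /mem_subsets s2.
  rewrite desc_counts_cat; last first.
    by move=> x y /mapP[v _ ->] /(mem_subseq s2) /fverts_cons_prefix; apply.
  rewrite desc_counts_map; last by move=> x y _ _ /=; rewrite eqxx.
  have [F1 ->] := desc_counts_forest (subseq_sorted ltx_trans s1 (sorted_verts u)).
  have [F2 ->] := desc_counts_forest (subseq_sorted ltx_trans s2 (sorted_fverts i.+1 us)).
  exact: fcode_cat_split.
have ci us i G : c i G us = c 0 G us.
  elim: us i G => // u us IH i G; rewrite !cE.
  by apply: eq_bigr => j _; rewrite IH [in RHS]IH.
by rewrite -[LHS]/(c 0 F (t :: ts)) cE; apply: eq_bigr => j _; rewrite ci.
Qed.

Lemma fcount_nil F : fcount F [::] = (if F is [::] then 1 else 0).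
Proof. by case: F => [|[F1] F2]. Qed.

(* [(tweight t).-1.-1] is the exponent [w] such that the good embeddings of [t] have
   a generating function of order [(1 - 4z)^(-w/2)]; a tree with [n] vertices and [l]
   leaves has [w = n + l - 2]. *)
Fixpoint tweight (t : ptree) : nat :=
  let: Node F := t in (sumn (map tweight F)).-1.+2.

Definition fweight (F : seq ptree) : nat := sumn (map tweight F).

Lemma fweight_cat F1 F2 : fweight (F1 ++ F2) = fweight F1 + fweight F2.
Proof. by rewrite /fweight map_cat sumn_cat. Qed.

(** Weights add over a forest, so it suffices to treat one host tree. There, using the host root for
    the root of a single tree changes both weights by the same monotone map. *)
Lemma fcount_fweight F ts : 0 < fcount F ts -> fweight F <= fweight ts.
Proof.
elim/forest_ind: ts F => [|G1 G2 IH1 IH2] F.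
  by rewrite fcount_nil; case: F.
rewrite fcount_cons lt0n sum_nat_eq0 => /forallPn[j].
rewrite /= muln_eq0 negb_or -!lt0n => /andP[h1 /IH2 h2].
rewrite -(cat_take_drop j F) fweight_cat leq_add //.
change (fweight (take j F) <= (fweight G1).-1.+2).
move: h1; rewrite tcount_Node addn_gt0 => /orP[/IH1 h|].
  by apply: leq_trans h _; case: (fweight G1) => // m; rewrite ltnW.
case: (take j F) => [|[F1] [|? ?]] // /IH1 h.
rewrite /fweight /= addn0 -/(fweight F1) !ltnS.
by rewrite -!subn1 leq_sub2r.
Qed.

Lemma ptree_sub_fweight F1 F2 :
  ptree_sub (Node F1) (Node F2) -> (fweight F1).-1 <= (fweight F2).-1.
Proof.
move=> [E hE].
(* [E] is an arbitrary list; it is replaced by the preorder sublist with the same elements, so that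
   codes apply. *)
have {hE} : is_embedding (Node F1) (Node F2) [seq v <- verts (Node F2) | v \in E].
  case: hE => ET [f [h1 [h2 [h3 h4]]]]; split.
    by move=> v; rewrite mem_filter => /andP[].
  exists f; split; [|split] => // y; rewrite mem_filter -h2.
  by split=> [/andP[]|yE] //; rewrite yE (ET _ yE).
move=> /is_embeddingP - /(_ (filter_subseq _ _)) /eqP e.
have : 0 < tcount [:: Node F1] (Node F2).
  rewrite -has_count; apply/hasP; eexists; last exact: e.
  exact: filter_in_subsets.
rewrite tcount_Node addn_gt0 => /orP[/fcount_fweight h|/fcount_fweight h].
  rewrite -!subn1 leq_sub2r // (leq_trans _ h) // /fweight /= addn0.
  by case: (sumn _) => // m; rewrite ltnW.
by rewrite -!subn1 leq_sub2r.
Qed.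

End Embeddings.

(** * Formal power series *)

(** The record separates the Cauchy product from the pointwise product of functions. *)
Record fps (R : Type) := Fps { coefs :> nat -> R }.

HB.instance Definition _ (R : Type) := gen_eqMixin (fps R).
HB.instance Definition _ (R : Type) := gen_choiceMixin (fps R).

Lemma fpsP (R : Type) (f g : fps R) : f =1 g -> f = g.
Proof. by case: f g => [f] [g] /= /funext->. Qed.

Definition fps_zero (R : comNzRingType) : fps R := Fps (fun=> 0).
Definition fps_add (R : comNzRingType) (f g : fps R) := Fps (fun n => f n + g n).
Definition fps_opp (R : comNzRingType) (f : fps R) := Fps (fun n => - f n).

Lemma fps_addA (R : comNzRingType) : associative (@fps_add R).
Proof. by move=> f g h; apply: fpsP => n /=; rewrite addrA. Qed.
Lemma fps_addC (R : comNzRingType) : commutative (@fps_add R).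
Proof. by move=> f g; apply: fpsP => n /=; rewrite addrC. Qed.
Lemma fps_add0 (R : comNzRingType) : left_id (fps_zero R) (@fps_add R).
Proof. by move=> f; apply: fpsP => n /=; rewrite add0r. Qed.
Lemma fps_addN (R : comNzRingType) : left_inverse (fps_zero R) (@fps_opp R) (@fps_add R).
Proof. by move=> f; apply: fpsP => n /=; rewrite addNr. Qed.

HB.instance Definition _ (R : comNzRingType) := GRing.isZmodule.Build (fps R)
  (@fps_addA R) (@fps_addC R) (@fps_add0 R) (@fps_addN R).

Definition fps_one (R : comNzRingType) : fps R := Fps (fun n => (n == 0%N)%:R).
Definition fps_mul (R : comNzRingType) (f g : fps R) :=
  Fps (fun n => \sum_(i < n.+1) f i * g (n - i)%N).

Definition fps_trunc (R : comNzRingType) N (f : fps R) : {poly R} := \poly_(i < N) f i.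

(** A coefficient of a product involves only finitely many coefficients, so associativity and
    commutativity are inherited from polynomials. *)
Lemma fps_mul_trunc (R : comNzRingType) (f g : fps R) n N : (n < N)%N ->
  fps_mul f g n = (fps_trunc N f * fps_trunc N g)`_n.
Proof.
move=> nN; rewrite coefM; apply: eq_bigr => i _; rewrite !coef_poly.
by rewrite (leq_ltn_trans _ nN) ?leq_ord // (leq_ltn_trans _ nN) ?leq_subr.
Qed.

Lemma fps_mulA (R : comNzRingType) : associative (@fps_mul R).
Proof.
move=> f g h; apply: fpsP => n.
rewrite !(fps_mul_trunc _ _ (ltnSn n)).
have -> : (fps_trunc n.+1 f * fps_trunc n.+1 (fps_mul g h))`_n =
  (fps_trunc n.+1 f * (fps_trunc n.+1 g * fps_trunc n.+1 h))`_n.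
  rewrite !coefM; apply: eq_bigr => i _; congr (_ * _).
  by rewrite coef_poly ltnS leq_subr (@fps_mul_trunc _ _ _ _ n.+1) // ltnS leq_subr.
rewrite mulrA !coefM; apply: eq_bigr => i _; congr (_ * _).
by rewrite coef_poly ltn_ord (@fps_mul_trunc _ _ _ _ n.+1).
Qed.

Lemma fps_mulC (R : comNzRingType) : commutative (@fps_mul R).
Proof.
by move=> f g; apply: fpsP => n; rewrite !(fps_mul_trunc _ _ (ltnSn n)) mulrC.
Qed.

Lemma fps_mul1 (R : comNzRingType) : left_id (fps_one R) (@fps_mul R).
Proof.
move=> f; apply: fpsP => n /=; rewrite big_ord_recl /= mul1r subn0 big1 ?addr0 //.
by move=> i _; rewrite mul0r.
Qed.

Lemma fps_mulDl (R : comNzRingType) : left_distributive (@fps_mul R) +%R.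
Proof.
move=> f g h; apply: fpsP => n /=; rewrite -big_split /=.
by apply: eq_bigr => i _; rewrite mulrDl.
Qed.

Lemma fps_one_neq0 (R : comNzRingType) : fps_one R != 0.
Proof.
by apply/eqP => /(congr1 (fun f => coefs f 0%N))/eqP; rewrite oner_eq0.
Qed.

HB.instance Definition _ (R : comNzRingType) := GRing.Zmodule_isComNzRing.Build (fps R)
  (@fps_mulA R) (@fps_mulC R) (@fps_mul1 R) (@fps_mulDl R) (@fps_one_neq0 R).

Lemma coef_fpsD (R : comNzRingType) (f g : fps R) n : (f + g) n = f n + g n.
Proof. by []. Qed.

Lemma coef_fpsN (R : comNzRingType) (f : fps R) n : (- f) n = - f n.
Proof. by []. Qed.

Lemma coef_fpsM (R : comNzRingType) (f g : fps R) n :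
  (f * g) n = \sum_(i < n.+1) f i * g (n - i)%N.
Proof. by []. Qed.

Lemma coef_fps_sum (R : comNzRingType) (I : finType) (F : I -> fps R) n :
  (\sum_i F i) n = \sum_i F i n.
Proof. by apply: (big_morph (fun f : fps R => f n)). Qed.

Definition fpsC (R : comNzRingType) (c : R) : fps R := Fps (fun n => c *+ (n == 0%N)).

Lemma coef_fpsCM (R : comNzRingType) (c : R) f n : (fpsC c * f) n = c * f n.
Proof.
rewrite coef_fpsM big_ord_recl /= subn0 big1 ?addr0 // => i _.
by rewrite mulr0n mul0r.
Qed.

Lemma fpsCD (R : comNzRingType) (a b : R) : fpsC (a + b) = fpsC a + fpsC b.
Proof. by apply: fpsP => n /=; rewrite mulrnDl. Qed.

Lemma fpsCM (R : comNzRingType) (a b : R) : fpsC (a * b) = fpsC a * fpsC b.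
Proof. by apply: fpsP => n; rewrite coef_fpsCM /= mulrnAr. Qed.

Lemma fpsC1 (R : comNzRingType) : fpsC (1 : R) = 1.
Proof. by apply: fpsP => -[]. Qed.

Definition fpsX (R : comNzRingType) : fps R := Fps (fun n => (n == 1%N)%:R).

Lemma coef_fpsXM0 (R : comNzRingType) (f : fps R) : (fpsX R * f) 0%N = 0.
Proof. by rewrite coef_fpsM big_ord1 mul0r. Qed.

Lemma coef_fpsXMS (R : comNzRingType) (f : fps R) n : (fpsX R * f) n.+1 = f n.
Proof.
rewrite coef_fpsM !big_ord_recl /= mul0r add0r mul1r subSS subn0 big1 ?addr0 //.
by move=> i _; rewrite mul0r.
Qed.

(** The coefficients of [g] vanish one after another. This serves to select the correct square root
    of 1 - 4z. *)
Lemma fps_mulf_eq0 (R : idomainType) (f g : fps R) : f 0%N != 0 -> f * g = 0 -> g = 0.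
Proof.
move=> f0 fg; apply: fpsP => n; rewrite [RHS]/=.
elim/ltn_ind: n => n IH.
have := congr1 (fun h => coefs h n) fg; rewrite /= big_ord_recl subn0 big1 => [|i _].
  by rewrite addr0 => /eqP; rewrite mulf_eq0 (negbTE f0) => /eqP.
by rewrite IH ?mulr0 // ltn_subrL (leq_ltn_trans _ (ltn_ord i)).
Qed.

(** * Expansions at the singularity *)

(* The coefficients of [(1 - 4z)^(-b/2)]. *)
Definition sing_coef (R : realType) (b : R) (n : nat) : R :=
  \prod_(i < n) ((4 * i%:R + 2 * b) / i.+1%:R).

Definition sing (R : realType) (b : R) : fps R := Fps (sing_coef b).

(** In coefficients, this is the differential equation (1 - 4z) f' = 2b f. *)
Lemma sing_coefS (R : realType) (b : R) n :
  n.+1%:R * sing_coef b n.+1 = (4 * n%:R + 2 * b) * sing_coef b n.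
Proof.
rewrite /sing_coef big_ord_recr /= mulrC -mulrA mulfVK ?pnatr_eq0 //.
by rewrite mulrC.
Qed.

Lemma sing0 (R : realType) : sing (0 : R) = 1.
Proof.
apply: fpsP => -[|n] /=; first by rewrite /sing_coef big_ord0.
by rewrite /sing_coef big_ord_recl /= !mulr0 addr0 !mul0r.
Qed.

Lemma singN2 (R : realType) : sing (-2 : R) = 1 - fpsC 4 * fpsX R.
Proof.
apply: fpsP => n; rewrite coef_fpsD coef_fpsN coef_fpsCM /=.
case: n => [|[|n]]; rewrite /sing_coef ?big_ord0 ?big_ord1 /=.
- by rewrite mulr0 subr0.
- by field.
- by rewrite 2!big_ord_recl /= /bump /=; field; rewrite ?pnatr_eq0.
Qed.

Lemma singD (R : realType) (a b : R) : sing a * sing b = sing (a + b).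
Proof.
apply: fpsP; elim=> [|n IH].
  by rewrite coef_fpsM big_ord1 /= /sing_coef !big_ord0 mulr1.
apply: (mulfI (x := n.+1%:R)); first by rewrite pnatr_eq0.
rewrite /= -/(sing_coef _ _) sing_coefS -[sing_coef _ _]IH !coef_fpsM /=.
(* The product rule: the factor n + 1 is split as i + (n + 1 - i), and the recurrence is applied to
   each factor. *)
transitivity (\sum_(i < n.+2) (i%:R * sing_coef a i) * sing_coef b (n.+1 - i) +
  \sum_(i < n.+2) sing_coef a i * ((n.+1 - i)%:R * sing_coef b (n.+1 - i)) : R).
  rewrite -big_split mulr_sumr; apply: eq_bigr => i _ /=.
  have -> : n.+1%:R = i%:R + (n.+1 - i)%:R :> R by rewrite -natrD subnKC // -ltnS.
  by ring.
rewrite big_ord_recl mul0r mul0r add0r.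
rewrite [X in _ + X]big_ord_recr /= subnn mul0r mulr0 addr0 -big_split mulr_sumr.
apply: eq_bigr => i _ /=; rewrite sing_coefS subSS subSn ?leq_ord // sing_coefS.
by rewrite natrB ?leq_ord //; ring.
Qed.

(* The tail of an expansion at the singularity: combinations of the series
   [(1 - 4z)^(-b/2)] with [b <= w]. *)
Inductive sing_span (R : realType) (w : R) : fps R -> Prop :=
| sing_span0 : sing_span w 0
| sing_spanZ (c b : R) : b <= w -> sing_span w (fpsC c * sing b)
| sing_spanD f g : sing_span w f -> sing_span w g -> sing_span w (f + g).

Lemma sing_span_le (R : realType) (w w' : R) f :
  w <= w' -> sing_span w f -> sing_span w' f.
Proof.
move=> ww'; elim=> [|c b bw|g h _ IHg _ IHh]; first exact: sing_span0.
- exact/sing_spanZ/(le_trans bw).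
- exact: sing_spanD.
Qed.

Lemma sing_spanM (R : realType) (w w' : R) f g :
  sing_span w f -> sing_span w' g -> sing_span (w + w') (f * g).
Proof.
move=> + hg; elim=> [|c b bw|f1 f2 _ IH1 _ IH2].
- by rewrite mul0r; exact: sing_span0.
- elim: hg => [|c' b' bw'|g1 g2 _ IH1 _ IH2].
  + by rewrite mulr0; exact: sing_span0.
  + have -> : fpsC c * sing b * (fpsC c' * sing b') = fpsC (c * c') * sing (b + b').
      by rewrite fpsCM -singD; ring.
    by apply: sing_spanZ; rewrite lerD.
  + by rewrite mulrDr; exact: sing_spanD.
- by rewrite mulrDl; exact: sing_spanD.
Qed.

(** A gap of one in the exponent makes coefficients smaller by a factor of order n^(-1/2), so the
    remainder is negligible in the limit. *)
Definition sing_lead (R : realType) (w c : R) (f : fps R) : Prop :=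
  exists2 g, f = fpsC c * sing w + g & sing_span (w - 1) g.

Lemma sing_lead_span (R : realType) (w c : R) f : sing_lead w c f -> sing_span w f.
Proof.
case=> g -> hg; apply: sing_spanD; first exact: sing_spanZ.
by apply: sing_span_le hg; rewrite gerBl.
Qed.

Lemma sing_leadDl (R : realType) (w c : R) f g :
  sing_lead w c f -> sing_span (w - 1) g -> sing_lead w c (f + g).
Proof.
by case=> h -> hh hg; exists (h + g); [rewrite addrA | exact: sing_spanD].
Qed.

Lemma sing_leadD (R : realType) (w c d : R) f g :
  sing_lead w c f -> sing_lead w d g -> sing_lead w (c + d) (f + g).
Proof.
case=> h -> hh [k -> hk]; exists (h + k); last exact: sing_spanD.
by rewrite fpsCD; ring.
Qed.

Lemma sing_leadM (R : realType) (v w c d : R) f g :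
  sing_lead v c f -> sing_lead w d g -> sing_lead (v + w) (c * d) (f * g).
Proof.
move=> hf hg; have sg := sing_lead_span hg.
case: hf hg => h -> hh [k eg hk].
exists (fpsC c * sing v * k + h * g).
  by rewrite eg fpsCM -singD; ring.
apply: sing_spanD.
  rewrite -addrA; apply: sing_spanM => //; exact: sing_spanZ.
by rewrite addrAC; apply: sing_spanM.
Qed.

Lemma sing_lead_sing (R : realType) (w : R) : sing_lead w 1 (sing w).
Proof. by exists 0; [rewrite fpsC1 mul1r addr0 | exact: sing_span0]. Qed.

(** Positive leading constants cannot cancel, and the index type is nonempty. *)
Lemma sing_lead_sum (R : realType) (w : R) m (F : 'I_m.+1 -> fps R) :
  (forall i, exists2 c, 0 < c & sing_lead w c (F i)) ->
  exists2 c, 0 < c & sing_lead w c (\sum_i F i).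
Proof.
elim: m F => [|m IH] F hF; first by rewrite big_ord1.
rewrite big_ord_recl; have [c c0 hc] := hF ord0.
have [|d d0 hd] := IH (fun i => F (lift ord0 i)); first by move=> i; exact: hF.
by exists (c + d); [rewrite addr_gt0 | exact: sing_leadD].
Qed.

(** * Generating functions of embeddings *)

Lemma forestsSS m k :
  forests m.+1 k.+1 =
  flatten [seq flatten [seq [seq Node f1 :: f2 | f2 <- forests m (k - j)]
                       | f1 <- forests m j]
          | j <- index_iota 0 k.+1].
Proof. by []. Qed.

Lemma forests_fuel m m' k : (k < m)%N -> (k < m')%N -> forests m k = forests m' k.
Proof.
elim: m m' k => // m IH [|m'] [|k] //; rewrite !ltnS => km km'.
rewrite !forestsSS; congr flatten; apply/eq_in_map => j.
rewrite mem_index_iota ltnS => /andP[_ jk].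
rewrite (IH m' j) ?(leq_ltn_trans jk) //; congr flatten; apply: eq_map => f1.
by rewrite (IH m') // (leq_ltn_trans (leq_subr _ _)).
Qed.

Lemma sum_forestsS (V : nmodType) (a : seq ptree -> V) k :
  \sum_(f <- forests k.+2 k.+1) a f =
  \sum_(j < k.+1) \sum_(f1 <- forests j.+1 j)
    \sum_(f2 <- forests (k - j).+1 (k - j)) a (Node f1 :: f2).
Proof.
have -> : forests k.+2 k.+1 =
    flatten [seq flatten [seq [seq Node f1 :: f2 | f2 <- forests (k - j).+1 (k - j)]
    | f1 <- forests j.+1 j] | j <- index_iota 0 k.+1].
  rewrite forestsSS; congr flatten; apply/eq_in_map => j.
  rewrite mem_index_iota ltnS => /andP[_ jk].
  rewrite (@forests_fuel k.+1 j.+1 j) ?ltnS //; congr flatten; apply: eq_map => f1.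
  by rewrite (@forests_fuel k.+1 (k - j).+1) // ltnS leq_subr.
rewrite big_flatten big_map big_mkord; apply: eq_bigr => j _.
by rewrite big_flatten big_map; apply: eq_bigr => f1 _; rewrite big_map.
Qed.

Definition forest_gf (R : realType) (F : seq ptree) : fps R :=
  Fps (fun n => (\sum_(f <- forests n.+1 n) fcount F f)%:R).

(* Contribution of the embeddings that use the root of the host tree. *)
Definition root_gf (R : realType) (F : seq ptree) : fps R :=
  if F is [:: Node F'] then forest_gf R F' else 0.

Lemma sum_tcount (R : realType) F n :
  (\sum_(f <- forests n.+1 n) tcount F (Node f))%:R =
  (forest_gf R F + root_gf R F) n :> R.
Proof.
under eq_bigr => f _ do rewrite tcount_Node.
rewrite big_split natrD coef_fpsD /=; congr (_ + _).
by case: F => [|[F] [|? ?]] //=; rewrite big1.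
Qed.

(** The constant term accounts for the empty host. Otherwise the first host tree receives the
    initial segment of length [i], and [fpsX R] counts its root. *)
Lemma forest_gfE (R : realType) F :
  forest_gf R F = (if F is [::] then 1 else 0) +
  \sum_(i < (size F).+1) fpsX R *
    ((forest_gf R (take i F) + root_gf R (take i F)) * forest_gf R (drop i F)).
Proof.
apply: fpsP => -[|n]; rewrite coef_fpsD coef_fps_sum.
  rewrite big1 => [|i _]; last by rewrite coef_fpsXM0.
  by rewrite addr0 /= big_seq1 fcount_nil; case: F.
have -> : (if F is [::] then 1 else 0 : fps R) n.+1 = 0 by case: F.
rewrite add0r [LHS]/= sum_forestsS.
under [RHS]eq_bigr => i _ do rewrite coef_fpsXMS coef_fpsM.
rewrite [RHS]exchange_big natr_sum; apply: eq_bigr => j _.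
under [RHS]eq_bigr => i _ do rewrite -sum_tcount [coefs (forest_gf _ _) _]/= -natrM.
rewrite -natr_sum; congr (_%:R).
under [RHS]eq_bigr => i _ do rewrite big_distrl.
rewrite [RHS]exchange_big; apply: eq_bigr => f1 _ /=.
under [LHS]eq_bigr => f2 _ do rewrite fcount_cons.
rewrite exchange_big; apply: eq_bigr => i _ /=.
by rewrite big_distrr.
Qed.

(** The series [C] of plane trees satisfies C = z + C^2, so (1 - 2C)^2 = 1 - 4z. Both roots have
    constant term 1, so their sum can be cancelled from the difference of squares. *)
Lemma sing_forest_gf_nil (R : realType) :
  sing (-1 : R) = 1 - fpsC 2 * (fpsX R * forest_gf R [::]).
Proof.
set C := fpsX R * _.
have eC : C = fpsX R + C * C.
  by rewrite /C {1}forest_gfE big_ord1 /= addr0; ring.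
have e4 : fpsC 4 = fpsC 2 * fpsC 2 :> fps R by rewrite -fpsCM; congr fpsC; ring.
have e2 : fpsC 2 = 1 + 1 :> fps R by rewrite -fpsC1 -fpsCD.
apply/eqP; rewrite -subr_eq0; apply/eqP.
apply: (@fps_mulf_eq0 _ (sing (-1) + (1 - fpsC 2 * C))).
  rewrite !coef_fpsD coef_fpsN coef_fpsCM coef_fpsXM0 mulr0 subr0 /=.
  by rewrite /sing_coef big_ord0 -mulr2n pnatr_eq0.
have -> : (sing (-1) + (1 - fpsC 2 * C)) * (sing (-1) - (1 - fpsC 2 * C)) =
  sing (-1) * sing (-1) - (1 - fpsC 2 * C) * (1 - fpsC 2 * C) by ring.
have -> : (1 - fpsC 2 * C) * (1 - fpsC 2 * C) = 1 - fpsC 4 * (C - C * C).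
  by rewrite e4 e2; ring.
rewrite {1}eC addrK singD.
have -> : (-1) + (-1) = -2 :> R by ring.
by rewrite singN2 subrr.
Qed.

Lemma sing_lead_forest_gf_nil (R : realType) :
  sing_lead 0 (2^-1) (fpsX R * forest_gf R [::]).
Proof.
exists (fpsC (- 2^-1) * sing (-1)); last by apply: sing_spanZ; rewrite sub0r.
have e2 : fpsC 2^-1 * fpsC 2 = 1 :> fps R by rewrite -fpsCM mulVf ?pnatr_eq0 // fpsC1.
have -> : fpsC (- 2^-1) = - fpsC 2^-1 :> fps R.
  by apply: fpsP => n /=; rewrite mulNrn.
rewrite sing_forest_gf_nil sing0; set C := fpsX R * _.
by rewrite -[LHS]mul1r -e2; ring.
Qed.

(* [s * f = g] for [s = sqrt (1 - 4z)]. *)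
Lemma sing_solve (R : realType) (f g : fps R) :
  f = fpsC 2 * (fpsX R * forest_gf R [::]) * f + g -> f = sing 1 * g.
Proof.
move=> e; have -> : g = sing (-1) * f by rewrite sing_forest_gf_nil mulrBl mul1r {1}e; ring.
by rewrite mulrA singD subrr sing0 mul1r.
Qed.

(** The tree lies entirely outside or entirely inside the first host tree. Each case reproduces the
    unknown with factor [C], and 1 - 2C = s is then inverted. *)
Lemma forest_gf_single (R : realType) F :
  fpsX R * forest_gf R [:: Node F] =
  sing 1 * (fpsX R * forest_gf R [::] * (fpsX R * forest_gf R F)).
Proof.
have e2 : fpsC 2 = 1 + 1 :> fps R by rewrite -fpsC1 -fpsCD.
apply: sing_solve; rewrite {1}forest_gfE big_ord_recl big_ord1 /= e2; ring.
Qed.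

(** The two trivial splits again contribute 2C times the unknown. They have no root term, since [F]
    has at least two trees; only proper splits remain. *)
Lemma forest_gf_many (R : realType) t1 t2 F0 (F := [:: t1, t2 & F0]) :
  fpsX R * forest_gf R F = sing 1 * \sum_(i < (size F0).+1)
    (fpsX R * forest_gf R (take i.+1 F) + fpsX R * root_gf R (take i.+1 F)) *
    (fpsX R * forest_gf R (drop i.+1 F)).
Proof.
have e2 : fpsC 2 = 1 + 1 :> fps R by rewrite -fpsC1 -fpsCD.
apply: sing_solve; rewrite {1}forest_gfE add0r [size F]/= big_ord_recl big_ord_recr.
rewrite [take ord0 F]/= [drop ord0 F]/= [root_gf R [::]]/=.
set k := lift ord0 ord_max; have -> : k = size F :> nat by [].
have -> : root_gf R (take (size F) F) = 0 by rewrite take_size /F; case: (t1).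
rewrite take_size drop_size e2.
set S1 := \sum_(i < _) _; set S2 := \sum_(i < _) _.
have -> : S2 = fpsX R * S1.
  rewrite mulr_sumr; apply: eq_bigr => i _.
  by rewrite lift0 [nat_of_ord (widen_ord _ _)]/=; ring.
by rewrite -/F /=; ring.
Qed.

Lemma size_fcode_gt0 F : (0 < size F)%N -> (0 < size (fcode F))%N.
Proof. by case: F => // -[]. Qed.

Lemma fweight_gt0 F : (0 < size F)%N -> (0 < fweight F)%N.
Proof. by case: F => // -[]. Qed.

(** Induction on the number of vertices. All proper splits have the same leading exponent, because
    weights are additive, and positive constants. *)
Lemma sing_lead_forest_gf (R : realType) F :
  exists2 c : R, 0 < c & sing_lead (fweight F).-1%:R c (fpsX R * forest_gf R F).
Proof.
have [n] := ubnP (size (fcode F)); elim: n F => // n IH [|[F] [|t2 F0]].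
- by move=> _; exists 2^-1; [rewrite invr_gt0 | exact: sing_lead_forest_gf_nil].
- rewrite fcode_cons cats0 ltnS => /IH[c c0 hc].
  exists (1 * (2^-1 * c)); first by rewrite mul1r mulr_gt0 ?invr_gt0.
  rewrite forest_gf_single.
  have -> : (fweight [:: Node F]).-1%:R = 1 + (0 + (fweight F).-1%:R) :> R.
    by rewrite /fweight /= addn0 -/(fweight F) -natr1; ring.
  apply: sing_leadM; first exact: sing_lead_sing.
  by apply: sing_leadM => //; exact: sing_lead_forest_gf_nil.
rewrite forest_gf_many; set F1 := [:: Node F, t2 & F0] => ltFn.
have [|c c0 hc] := @sing_lead_sum R ((fweight F1)%:R - 2) (size F0) (fun i =>
  (fpsX R * forest_gf R (take i.+1 F1) + fpsX R * root_gf R (take i.+1 F1)) *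
  (fpsX R * forest_gf R (drop i.+1 F1))); last first.
  exists (1 * c); first by rewrite mul1r.
  have -> : (fweight F1).-1%:R = 1 + ((fweight F1)%:R - 2) :> R.
    have /prednK <- : (0 < fweight F1)%N by exact: fweight_gt0.
    by rewrite [_.+1.-1]/= -[in RHS]natr1; ring.
  by apply: sing_leadM => //; exact: sing_lead_sing.
move=> i; set A := take _ _; set B := drop _ _.
have eF : F1 = A ++ B by rewrite cat_take_drop.
have szA : (0 < size A)%N by [].
have szB : (0 < size B)%N by rewrite size_drop subn_gt0 /= ltnS ltn_ord.
move: ltFn; rewrite eF fcode_cat size_cat => ltFn.
have [a a0 hA] : exists2 c : R, 0 < c &
    sing_lead (fweight A).-1%:R c (fpsX R * forest_gf R A).
  by apply: IH; rewrite -ltnS (leq_trans _ ltFn) // ltnS -addn1 leq_add2l size_fcode_gt0.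
have [b b0 hB] : exists2 c : R, 0 < c &
    sing_lead (fweight B).-1%:R c (fpsX R * forest_gf R B).
  by apply: IH; rewrite -ltnS (leq_trans _ ltFn) // ltnS -add1n leq_add2r size_fcode_gt0.
exists (a * b); first exact: mulr_gt0.
have -> : (fweight (A ++ B))%:R - 2 = (fweight A).-1%:R + (fweight B).-1%:R :> R.
  rewrite fweight_cat -(prednK (fweight_gt0 szA)) -(prednK (fweight_gt0 szB)) /=.
  by rewrite natrD -!natr1; ring.
apply: sing_leadM => //; apply: sing_leadDl => //.
(* Using the host root for the single tree [A] lowers the exponent by one, so the root term joins
   the remainder. *)
case: A ltFn {eF szA hA a a0} => [|[F'] [|? ?]] ltFn; rewrite /root_gf ?mulr0;
  try exact: sing_span0.
have [|c c0 /sing_lead_span] := IH F'.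
  by rewrite -ltnS (leq_trans _ ltFn) // fcode_cons cats0 ltnS leq_addr.
apply: sing_span_le; rewrite /fweight /= addn0 -/(fweight F') -natr1.
by rewrite addrK.
Qed.


(** * Asymptotics of the coefficients *)

Lemma sing_coef_gt0 (R : realType) (b : R) n : 0 < b -> 0 < sing_coef b n.
Proof.
move=> b0; apply: prodr_gt0 => i _; rewrite divr_gt0 ?ltr0n //.
by rewrite ltr_wpDl ?mulr_ge0 ?ler0n // mulr_gt0.
Qed.

Lemma sing_coef_ge0 (R : realType) (b : R) n : 0 <= b -> 0 <= sing_coef b n.
Proof. by move=> b0; apply: prodr_ge0 => i _; rewrite divr_ge0 ?addr_ge0 ?mulr_ge0. Qed.

Lemma sing_ratioS (R : realType) (a b : R) n : 0 < b ->
  sing_coef a n.+1 / sing_coef b n.+1 =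
  sing_coef a n / sing_coef b n * ((2 * n%:R + a) / (2 * n%:R + b)).
Proof.
move=> b0; have := sing_coef_gt0 n b0.
rewrite /sing_coef !big_ord_recr /= => /lt0r_neq0 sb.
have b1 : 2 * n%:R + b != 0 by rewrite lt0r_neq0 // ltr_wpDl // mulr_ge0 ?ler0n.
have b2 : 4 * n%:R + 2 * b != 0.
  by rewrite (_ : _ + _ = 2 * (2 * n%:R + b)) ?mulf_neq0 ?pnatr_eq0 //; ring.
have n1 : n.+1%:R != 0 :> R by rewrite pnatr_eq0.
by rewrite -natr1 in n1 *; field; rewrite sb b1 b2 n1.
Qed.

(** With X = 2n + b this reduces to (X + 2)(X - 1)^2 <= X^3. It shows that the ratio is O(n^(-1/2))
    once the exponents differ by at least 1. *)
Lemma sing_ratio_sqr_step (R : realType) (a b : R) n :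
  1 <= b -> a <= b - 1 -> 0 <= 2 * n%:R + a ->
  (2 * n.+1%:R + b) * (sing_coef a n.+1 / sing_coef b n.+1) ^+ 2 <=
  (2 * n%:R + b) * (sing_coef a n / sing_coef b n) ^+ 2.
Proof.
move=> b1 ab na; rewrite sing_ratioS ?(lt_le_trans ltr01) //.
set x := _ / sing_coef b n; have n0 : 0 <= n%:R :> R by rewrite ler0n.
rewrite exprMn mulrCA [leRHS]mulrC ler_wpM2l ?sqr_ge0 //.
have X1 : 1 <= 2 * n%:R + b by lra.
rewrite expr_div_n mulrA ler_pdivrMr; last by rewrite exprn_gt0 // (lt_le_trans ltr01).
rewrite -[n.+1%:R]natr1.
have -> : 2 * (n%:R + 1) + b = (2 * n%:R + b) + 2 by ring.
have : 2 * n%:R + a <= 2 * n%:R + b - 1 by lra.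
move: (2 * n%:R + a) (2 * n%:R + b) X1 na => Y X X1 Y0 YX.
apply: (@le_trans _ _ ((X + 2) * (X - 1) ^+ 2)).
  by rewrite ler_wpM2l ?ler_pXn2r ?nnegrE //; lra.
have -> : (X + 2) * (X - 1) ^+ 2 = X * X ^+ 2 - (3 * X - 2) by ring.
by rewrite gerBl; lra.
Qed.

(** A gap of 2 in the exponents improves the bound on the ratio to O(1/n), which survives
    multiplication by sqrt n. *)
Lemma sing_ratio_step (R : realType) (a b : R) n :
  1 <= b -> a <= b - 2 -> 0 <= 2 * n%:R + a ->
  (2 * n.+1%:R + b - 2) * `|sing_coef a n.+1 / sing_coef b n.+1| <=
  (2 * n%:R + b - 2) * `|sing_coef a n / sing_coef b n|.
Proof.
move=> b1 ab na; rewrite sing_ratioS ?(lt_le_trans ltr01) //.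
set x := _ / sing_coef b n; have n0 : 0 <= n%:R :> R by rewrite ler0n.
have X1 : 0 < 2 * n%:R + b by lra.
rewrite normrM mulrCA [leRHS]mulrC ler_wpM2l ?normr_ge0 //.
rewrite ger0_norm ?divr_ge0 ?(ltW X1) // mulrA ler_pdivrMr // mulrC -[n.+1%:R]natr1.
have -> : 2 * (n%:R + 1) + b - 2 = 2 * n%:R + b by ring.
by rewrite ler_wpM2r ?(ltW X1) //; lra.
Qed.

Lemma le_from (R : realType) (u : nat -> R) N :
  (forall n, (N <= n)%N -> u n.+1 <= u n) -> forall n, (N <= n)%N -> u n <= u N.
Proof.
move=> hu; elim=> [|n IH]; first by rewrite leqn0 => /eqP->.
by rewrite leq_eqVlt => /orP[/eqP->|Nn] //; apply: le_trans (hu n Nn) (IH Nn).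
Qed.

Lemma cvg0_sqr_bound (R : realType) (y : nat -> R) K N :
  (forall n, (N <= n)%N -> n%:R * y n ^+ 2 <= K) -> y @ \oo --> 0.
Proof.
move=> hy; apply/cvgr0Pnorm_lt => e e0; near=> n.
have nN : (N <= n)%N by near: n; exact: nbhs_infty_ge.
have nK : K / e ^+ 2 < n%:R by near: n; exact: nbhs_infty_gtr.
have n0 : 0 < n%:R :> R by rewrite ltr0n; near: n; exact: nbhs_infty_gt.
rewrite -(@ltr_pXn2r _ 2) ?nnegrE ?normr_ge0 ?(ltW e0) //.
rewrite real_normK ?num_real // -(ltr_pM2l n0) (le_lt_trans (hy n nN)) //.
by rewrite -ltr_pdivrMr // exprn_gt0.
Unshelve. all: by end_near. Qed.

(** Remainders may contain negative exponents, for which the monotonicity steps hold only from some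
    index on. *)
Lemma ex_shift_ge0 (R : realType) (a : R) :
  exists2 N, (0 < N)%N & forall n, (N <= n)%N -> 0 <= 2 * n%:R + a.
Proof.
exists (Num.bound `|a|).+1 => // n hn.
have ha : `|a| < (Num.bound `|a|)%:R by exact/archi_boundP/normr_ge0.
have : (Num.bound `|a|).+1%:R <= n%:R :> R by rewrite ler_nat.
rewrite -[_.+1%:R]natr1; have := ler_norm (- a); rewrite normrN; have := normr_ge0 a; lra.
Qed.

Lemma cvg_sing_ratio0 (R : realType) (a b : R) : 1 <= b -> a <= b - 1 ->
  (fun n => sing_coef a n / sing_coef b n) @ \oo --> 0.
Proof.
move=> b1 ab; have [N N0 hN] := ex_shift_ge0 a.
pose u n := (2 * n%:R + b) * (sing_coef a n / sing_coef b n) ^+ 2.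
apply: (@cvg0_sqr_bound _ _ (u N) N) => n nN.
have hu : u n <= u N.
  by apply: le_from nN => m Nm; apply: sing_ratio_sqr_step => //; exact: hN.
apply: le_trans hu; rewrite ler_wpM2r ?sqr_ge0 //.
by have : 0 <= n%:R :> R by []; lra.
Qed.

Lemma cvg_sqrt_sing_ratio0 (R : realType) (a b : R) : 1 <= b -> a <= b - 2 ->
  (fun n => Num.sqrt n%:R * (sing_coef a n / sing_coef b n)) @ \oo --> 0.
Proof.
move=> b1 ab; have [N N0 hN] := ex_shift_ge0 a.
pose v n := (2 * n%:R + b - 2) * `|sing_coef a n / sing_coef b n|.
apply: (@cvg0_sqr_bound _ _ (v N ^+ 2) N) => n nN.
have hv : v n <= v N.
  by apply: le_from nN => m Nm; apply: sing_ratio_step => //; exact: hN.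
have n1 : 1 <= n%:R :> R by rewrite ler1n (leq_trans N0).
(* For y = sqrt n x the quantity n y^2 equals (n x)^2, and n <= 2n + b - 2 because n and b are at
   least 1. *)
rewrite exprMn sqr_sqrtr ?ler0n // mulrA -expr2 -exprMn -[leLHS]real_normK ?num_real //.
have nv : `|n%:R * (sing_coef a n / sing_coef b n)| <= v N.
  apply: le_trans hv; rewrite normrM ler_wpM2r ?normr_ge0 // ger0_norm //; lra.
by rewrite ler_pXn2r ?nnegrE // (le_trans _ nv).
Qed.

(* [(2n + w + 1) x_n^2] is nonincreasing for [x_n] the ratio of the coefficients. *)
Lemma sing_ratio_cvg (R : realType) (w : nat) : exists l : R,
  (fun n => Num.sqrt n%:R * (sing_coef (w%:R : R) n / sing_coef w.+1%:R n)) @ \oo --> l.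
Proof.
pose x n : R := sing_coef w%:R n / sing_coef w.+1%:R n.
pose u n := (2 * n%:R + w.+1%:R) * x n ^+ 2.
have w1 : 1 <= w.+1%:R :> R by rewrite ler1n.
have ww : w%:R <= w.+1%:R - 1 :> R by rewrite -[w.+1%:R]natr1 addrK.
have u_cvg : cvgn u.
  apply: nonincreasing_is_cvgn.
    apply/nonincreasing_seqP => n; apply: sing_ratio_sqr_step => //.
  by exists 0 => _ [n _ <-]; rewrite mulr_ge0 ?sqr_ge0 // addr_ge0 ?mulr_ge0.
have x0 : x @ \oo --> 0 by exact: cvg_sing_ratio0.
(* Solving the definition of [u] for n x_n^2 gives (u_n - (w + 1) x_n^2) / 2, where x_n tends to
   0. *)
exists (Num.sqrt (2^-1 * (limn u - w.+1%:R * (0 * 0)))).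
have -> : (fun n => Num.sqrt n%:R * (sing_coef (w%:R : R) n / sing_coef w.+1%:R n)) =
  (fun n => Num.sqrt (2^-1 * (u n - w.+1%:R * (x n * x n)))).
  apply/funext => n; have xn : 0 <= x n.
    by rewrite divr_ge0 ?sing_coef_ge0.
  rewrite -/(x n) -[in LHS](@ger0_norm _ (x n)) // -sqrtr_sqr -sqrtrM ?ler0n //.
  by congr Num.sqrt; rewrite /u; field.
apply: (@continuous_cvg _ _ _ _ _ _ Num.sqrt); first exact: sqrt_continuous.
apply: (cvgM (cvg_cst _)); apply: cvgB; first exact: u_cvg.
exact: (cvgM (cvg_cst _) (cvgM x0 x0)).
Qed.

(** Log-concavity in the exponent holds factor by factor: (4i + 2w)(4i + 2(w + 2)) <= (4i + 2(w +
    1))^2. *)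
Lemma sing_ratio_le (R : realType) (v w : nat) n : (v <= w)%N ->
  sing_coef (v%:R : R) n / sing_coef v.+1%:R n <=
  sing_coef (w%:R : R) n / sing_coef w.+1%:R n.
Proof.
elim: w => [|w IH]; first by rewrite leqn0 => /eqP->.
rewrite leq_eqVlt => /orP[/eqP->//|/IH{IH} h]; apply: (le_trans h).
rewrite ler_pdivrMr ?sing_coef_gt0 // mulrAC ler_pdivlMr ?sing_coef_gt0 //.
rewrite /sing_coef -!big_split ler_prod // => i _ /=.
rewrite !mulf_div mulr_ge0 ?invr_ge0 ?mulr_ge0 ?addr_ge0 ?mulr_ge0 //=.
rewrite ler_wpM2r ?invr_ge0 ?mulr_ge0 //.
rewrite -[w.+2%:R]natr1 -[w.+1%:R]natr1.
by have : 0 <= w%:R :> R by []; have : 0 <= i%:R :> R by []; nra.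
Qed.

Lemma sing_span_cvg0 (R : realType) (b : R) f : 1 <= b -> sing_span (b - 1) f ->
  (fun n => f n / sing_coef b n) @ \oo --> 0.
Proof.
move=> b1; elim=> [|c a ab|g h _ IHg _ IHh].
- by under eq_fun do rewrite mul0r; exact: cvg_cst.
- under eq_fun do rewrite coef_fpsCM -mulrA.
  by rewrite -[0](mulr0 c); apply: (cvgM (cvg_cst _)); exact: cvg_sing_ratio0.
- under eq_fun do rewrite coef_fpsD mulrDl.
  by rewrite -[0]addr0; exact: cvgD.
Qed.

Lemma sing_span_sqrt_cvg0 (R : realType) (b : R) f : 1 <= b -> sing_span (b - 2) f ->
  (fun n => Num.sqrt n%:R * (f n / sing_coef b n)) @ \oo --> 0.
Proof.
move=> b1; elim=> [|c a ab|g h _ IHg _ IHh].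
- by under eq_fun do rewrite mul0r mulr0; exact: cvg_cst.
- under eq_fun do rewrite coef_fpsCM -mulrA mulrCA.
  by rewrite -[0](mulr0 c); apply: (cvgM (cvg_cst _)); exact: cvg_sqrt_sing_ratio0.
- under eq_fun do rewrite coef_fpsD mulrDl mulrDr.
  by rewrite -[0]addr0; exact: cvgD.
Qed.

(** Numerator and denominator are divided by the coefficient of exponent w + 1. The remainder of [f]
    has exponents at most (w + 1) - 2, so it vanishes even after multiplication by sqrt n. *)
Lemma sing_lead_ratio_cvg (R : realType) (w : nat) (c d l : R) f g : d != 0 ->
  sing_lead w%:R c f -> sing_lead w.+1%:R d g ->
  (fun n => Num.sqrt n%:R * (sing_coef (w%:R : R) n / sing_coef w.+1%:R n)) @ \oo --> l ->
  (fun n => Num.sqrt n%:R * (f n / g n)) @ \oo --> c * l / d.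
Proof.
move=> d0 [f' -> hf] [g' -> hg] hl.
have w1 : 1 <= w.+1%:R :> R by rewrite ler1n.
have e0 n : sing_coef (w.+1%:R : R) n != 0 by rewrite lt0r_neq0 // sing_coef_gt0.
set e := sing_coef w.+1%:R in e0 hl *.
have -> : (fun n => Num.sqrt n%:R *
    ((fpsC c * sing w%:R + f') n / (fpsC d * sing w.+1%:R + g') n)) =
  (fun n => (c * (Num.sqrt n%:R * (sing_coef w%:R n / e n)) +
    Num.sqrt n%:R * (f' n / e n)) / (d + g' n / e n)).
  apply/funext => n; rewrite !coef_fpsD !coef_fpsCM /= -/e.
  have -> : d + g' n / e n = (d * e n + g' n) / e n by field; rewrite e0.
  by rewrite invfM invrK; move: (_ + g' n)^-1 => u; field; rewrite e0.
apply: cvgM; last first.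
  apply: cvgV => //; rewrite -[d in _ --> d]addr0.
  by apply: cvgD; [exact: cvg_cst | exact: sing_span_cvg0].
rewrite -[c * l]addr0; apply: cvgD; first exact: (cvgM (cvg_cst _) hl).
apply: sing_span_sqrt_cvg0 => //; apply: sing_span_le hf.
by rewrite -[w.+1%:R]natr1; lra.
Qed.

(** * Good and all embeddings as coefficients, and the limit *)

Lemma coef_gT (R : realType) F n :
  (gT n (Node F))%:R = (fpsX R * forest_gf R F) n :> R.
Proof.
case: n => [|n]; first by rewrite coef_fpsXM0 /gT big_nil.
rewrite coef_fpsXMS /gT /trees big_map.
by under eq_bigr => f _ do rewrite num_good_embE.
Qed.

Lemma coef_aT (R : realType) F n :
  (aT n (Node F))%:R = (fpsX R * (forest_gf R [:: Node F] + forest_gf R F)) n :> R.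
Proof.
case: n => [|n]; first by rewrite coef_fpsXM0 /aT big_nil.
rewrite coef_fpsXMS /aT /trees big_map.
under eq_bigr => f _ do rewrite num_embE.
exact: sum_tcount.
Qed.

Lemma good_ratio_cvg (R : realType) F (l : R) :
  (fun n => Num.sqrt n%:R *
     (sing_coef ((fweight F).-1%:R : R) n / sing_coef (fweight F).-1.+1%:R n)) @ \oo --> l ->
  good_ratio R (Node F) @ \oo --> 2 * l.
Proof.
have [c c0 hc] := sing_lead_forest_gf R F.
have ha : sing_lead (fweight F).-1.+1%:R (1 * 2^-1 * c)
    (fpsX R * (forest_gf R [:: Node F] + forest_gf R F)).
  (* All embeddings are the good ones times C/s + 1, with leading term 1/(2s). The constant [c] of
     the pattern thus cancels in the ratio and leaves the factor 2. *)
  have -> : fpsX R * (forest_gf R [:: Node F] + forest_gf R F) =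
      (sing 1 * (fpsX R * forest_gf R [::]) + 1) * (fpsX R * forest_gf R F).
    by rewrite mulrDr forest_gf_single; ring.
  rewrite -[_.+1%:R]natr1 addrC; apply: sing_leadM => //.
  rewrite -[X in sing_lead X]addr0; apply: sing_leadDl.
    by apply: sing_leadM; [exact: sing_lead_sing | exact: sing_lead_forest_gf_nil].
  by rewrite -sing0 -[sing 0]mul1r -fpsC1; apply: sing_spanZ; rewrite addr0 subrr.
move=> hl; have := sing_lead_ratio_cvg _ hc ha hl.
have c1 : c != 0 by rewrite lt0r_neq0.
have -> : c * l / (1 * 2^-1 * c) = 2 * l by field.
have -> : good_ratio R (Node F) = fun n => Num.sqrt n%:R *
    ((fpsX R * forest_gf R F) n / (fpsX R * (forest_gf R [:: Node F] + forest_gf R F)) n).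
  by apply/funext => n; rewrite /good_ratio coef_gT coef_aT.
by apply; rewrite mul1r mulf_neq0 // invr_eq0 pnatr_eq0.
Qed.

Theorem theorem9 (R : realType) (S1 S2 : ptree) :
  ptree_sub S1 S2 ->
  exists l1 l2 : R,
    good_ratio R S1 @ \oo --> l1 /\ good_ratio R S2 @ \oo --> l2 /\ l1 <= l2.
Proof.
case: S1 S2 => [F1] [F2] /ptree_sub_fweight le_w.
have [l1 h1] := sing_ratio_cvg R (fweight F1).-1.
have [l2 h2] := sing_ratio_cvg R (fweight F2).-1.
exists (2 * l1), (2 * l2); split; [exact: good_ratio_cvg | split; first exact: good_ratio_cvg].
(* The coefficient ratios are compared for each [n], and the inequality passes to the limits. *)
rewrite ler_pM2l ?ltr0n //; apply: ler_cvg_to h1 h2 _.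
by apply: nearW => n; rewrite ler_wpM2l ?sqrtr_ge0 // sing_ratio_le.
Qed.
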